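(* Let $n,m\geq1$ be integers, let $Q\subset\mathbb{R}^{n+m}$ be a cube, let $X$ be a metric space, and let $f:Q\to X$ be Lipschitz. Then $$ \mathcal{H}^{n,m}_\infty(f,Q)\leq\frac{\omega_n}{2^n}(n+m)^{n/2}\int_Q\Theta_*^n(f,x)\,dx\leq\frac{\omega_n}{2^n}(n+m)^{n/2}\int_Q\Theta^{*n}(f,x)\,dx. $$
   Context: All cubes have edges parallel to the coordinate axes. $\omega_n$ is the volume of the unit ball in $\mathbb{R}^n$. The Hausdorff content of a subset $E$ of a metric space is $$ \mathcal{H}^n_\infty(E)=\inf\frac{\omega_n}{2^n}\sum_{i=1}^\infty(\operatorname{diam}A_i)^n, $$ where the infimum is over all countable coverings $E\subset\bigcup_{i=1}^\infty A_i$. For a measurable set $A\subset\mathbb{R}^{k}$, a mapping $f:A\to X$ into a metric space, and $x\in A$, the upper and lower $n$-densities of $f$ at $x$ are $$ \Theta^{*n}(f,x)=\limsup_{r\to0}\frac{\mathcal{H}^n_\infty(f(B(x,r)\cap A))}{\omega_n r^n},\qquad \Theta_*^{n}(f,x)=\liminf_{r\to0}\frac{\mathcal{H}^n_\infty(f(B(x,r)\cap A))}{\omega_n r^n}, $$ where $B(x,r)$ is the Euclidean ball. The $(n,m)$-Hausdorff content of a Lipschitz map $f:Q\to X$ from a cube $Q\subset\mathbb{R}^{n+m}$ is $$ \mathcal{H}^{n,m}_\infty(f,Q)=\inf\sum_{j=1}^\infty\mathcal{H}^n_\infty(f(Q_j))\,d_j^m, $$ where the infimum is over all (countable) families of open pairwise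 disjoint cubes $Q_j\subset Q$ of side length $d_j$ that cover $Q$ up to a set of Lebesgue measure zero. *)

(* Defs.v *)
From HB Require Import structures.
From mathcomp Require Import all_boot all_order all_algebra.
From mathcomp Require Import all_classical all_reals all_analysis.

Set Implicit Arguments.
Unset Strict Implicit.
Unset Printing Implicit Defensive.

Import Order.TTheory GRing.Theory Num.Theory.
Import numFieldNormedType.Exports.

Local Open Scope classical_set_scope.
Local Open Scope ring_scope.

(* R^k is represented by tuples because the library equips them with the product
   sigma-algebra, which for tuples of reals is the Borel sigma-algebra of R^k. *)
Notation euclid R k := (k.-tuple (measurableTypeR R)).

Section lebesgue_measure_tuple.
Context {R : realType}.
Local Open Scope ereal_scope.

Definition consp k (p : measurableTypeR R * euclid R k) : euclid R k.+1 :=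
  [tuple of p.1 :: p.2].

Lemma measurable_consp k : measurable_fun [set: _] (@consp k).
Proof. exact: (measurable_cons measurable_fst measurable_snd). Qed.

Section lebesgue_cons.
Context (k : nat) (m : {sigma_finite_measure set (euclid R k) -> \bar R}).

(* the product of Lebesgue measure on R and m, carried to R^(k+1) *)
Definition lebesgue_cons := pushforward (lebesgue_measure \x m) (@consp k).

HB.instance Definition _ := Measure.copy lebesgue_cons
  (measure_function_pushforward__canonical__measure_function_Measure
    (lebesgue_measure \x m) (@measurable_consp k)).

Let lebesgue_cons_sigma_finite : sigma_finite setT lebesgue_cons.
Proof.
have /sigma_finiteP[F [TF ndF Foo]] := sigma_finiteT (@lebesgue_measure R).
have /sigma_finiteP[G [TG ndG Goo]] := sigma_finiteT m.
exists (fun n => [set x : euclid R k.+1 |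
    F n (thead x) /\ G n [tuple of behead x]]) => [|n].
  apply/seteqP; split=> // x _.
  have [i _ Fi] : (\bigcup_i F i) (thead x) by rewrite -TF.
  have [j _ Gj] : (\bigcup_i G i) [tuple of behead x] by rewrite -TG.
  exists (maxn i j) => //; split.
    by move: Fi; apply/subsetPset/ndF/leq_maxl.
  by move: Gj; apply/subsetPset/ndG/leq_maxr.
have [mF Fi] := Foo n; have [mG Gi] := Goo n; split.
  apply: measurableI.
    by rewrite -[X in measurable X]setTI; exact: measurable_tnth.
  by rewrite -[X in measurable X]setTI; exact: measurable_behead.
rewrite /lebesgue_cons /pushforward (_ : _ @^-1` _ = F n `*` G n).
  by rewrite product_measure1E// lte_mul_pinfty// ge0_fin_numE.
apply/seteqP; split=> -[a t]/=; rewrite theadE.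
  by move=> [? Gt]; split=> //=; rewrite (_ : t = [tuple of behead (a :: t)])//;
    exact: val_inj.
by move=> [? Gt]; split=> //=; rewrite (_ : [tuple of _] = t)//; exact: val_inj.
Qed.

HB.instance Definition _ :=
  @Measure_isSigmaFinite.Build _ _ _ lebesgue_cons lebesgue_cons_sigma_finite.

End lebesgue_cons.

Fixpoint lebesgue_tuple (k : nat) :
    {sigma_finite_measure set (euclid R k) -> \bar R} :=
  if k is k'.+1 return {sigma_finite_measure set (euclid R k) -> \bar R}
  then lebesgue_cons (lebesgue_tuple k')
  else dirac [tuple].

End lebesgue_measure_tuple.

Section euclidean.
Context {R : realType} {k : nat}.
Implicit Types (a x y : euclid R k) (r d : R) (Q : set (euclid R k)).

(* The library's norm on 'rV[R]_k is the sup norm, not the Euclidean norm. *)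
Definition edist x y : R := Num.sqrt (\sum_(i < k) (tnth x i - tnth y i) ^+ 2).

Definition eball x r : set (euclid R k) := [set y | edist x y < r].

Definition open_cube a d : set (euclid R k) :=
  [set x | forall i, tnth a i < tnth x i < tnth a i + d].

(* The faces of the cube may or may not belong to it: with lo i = true the left
   endpoint of the i-th side is included, with hi i = false the right one is. *)
Definition is_cube Q : Prop :=
  exists (a : euclid R k) (d : R) (lo hi : 'I_k -> bool), 0 < d /\
    Q = [set x | forall i, tnth x i \in
      Interval (BSide (lo i) (tnth a i)) (BSide (hi i) (tnth a i + d))].

Definition lipschitz_map (X : metricType R) Q (f : euclid R k -> X) : Prop :=
  exists2 L : R, 0 <= L & forall x y, Q x -> Q y ->
    mdist (f x) (f y) <= L * edist x y.

End euclidean.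

Section contents.
Context {R : realType}.
Local Open Scope ereal_scope.

(* omega n is the volume of the unit ball of R^n. *)
Definition omega (n : nat) : R :=
  fine (lebesgue_tuple n (eball [tuple 0%R | _ < n] 1%R)).

(* 0 is added to the supremum so that the empty set has diameter 0, not -oo *)
Definition diam (X : metricType R) (A : set X) : \bar R :=
  ereal_sup (0 |` [set (mdist p.1 p.2)%:E | p in A `*` A]).

Definition hausdorff_content (X : metricType R) (n : nat) (E : set X) : \bar R :=
  ereal_inf [set (omega n / 2 ^+ n)%:E * \sum_(i <oo) diam (A i) ^+ n
            | A in [set A : nat -> set X | E `<=` \bigcup_i A i]].

Section density.
Context (X : metricType R) (k n : nat) (A : set (euclid R k))
  (f : euclid R k -> X) (x : euclid R k).

Definition density_ratio (r : R) : \bar R :=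
  hausdorff_content n (f @` (eball x r `&` A)) * ((omega n * r ^+ n)^-1)%:E.

Definition upper_density : \bar R := limf_esup density_ratio 0^'+.

Definition lower_density : \bar R := limf_einf density_ratio 0^'+.

End density.

(* The index set J makes both finite and infinite families available. *)
Definition cube_family (k : nat) (Q : set (euclid R k))
    (J : set nat) (a : nat -> euclid R k) (d : nat -> R) : Prop :=
  [/\ forall j, J j -> (0 < d j)%R,
      forall j, J j -> open_cube (a j) (d j) `<=` Q,
      trivIset J (fun j => open_cube (a j) (d j)) &
      (lebesgue_tuple k).-negligible
        (Q `\` \bigcup_(j in J) open_cube (a j) (d j))].

Definition hausdorff_content_map (X : metricType R) (n m : nat)
    (f : euclid R (n + m) -> X) (Q : set (euclid R (n + m))) : \bar R :=
  ereal_inf [set s | exists (J : set nat) (a : nat -> euclid R (n + m))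
                            (d : nat -> R),
    cube_family Q J a d /\
    s = \esum_(j in J)
          (hausdorff_content n (f @` open_cube (a j) (d j)) * (d j ^+ m)%:E)].

End contents.

Arguments hausdorff_content_map {R X} n m f Q.

(* Main.v *)
Require Import Defs.
From mathcomp Require Import all_boot all_order all_algebra.
From mathcomp Require Import all_classical all_reals all_analysis.
From mathcomp Require Import measurable_realfun ring lra.
Import Order.TTheory GRing.Theory Num.Theory.
Import numFieldNormedType.Exports.
Local Open Scope classical_set_scope.
Local Open Scope ring_scope.
Local Open Scope ereal_scope.

(** Write k = n + m and K = omega n / 2^n * k^(n/2).  The cube of side D centred
    at x lies in the ball of radius r = sqrt k * D / 2, and K D^n = omega n r^n.
    So if the content of the image of that ball is less than q omega n r^n, then
    the cube costs at most q K D^n * D^m, that is, q K times its volume.  When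
    the lower density at x is less than q, this happens at arbitrarily small
    scales, hence [x] lies in arbitrarily small cubes that are q-cheap in this
    sense.  The strict inequality leaves room to move the cube a little and to
    make its corner and side rational ([lower_density_vitali_limit]), so that
    one fixed countable family of cubes suffices; every set of points defined by
    cheap cubes is then measurable.

    A Vitali argument ([vitali_packing]) extends any finite packing by finitely
    many q-cheap cubes so that almost all of the points lying in arbitrarily
    small q-cheap cubes are covered.  Apply it with q = e, 2e, 3e, and so on,
    with errors 1/2, 1/4, 1/8, and so on.  Choosing the cheap cubes first makes a
    layer-cake estimate available: let L_l be the volume left over when the
    level l e has been treated.  A cube chosen at level l e lies in the l
    preceding leftovers, so the total cost is at most K e times the sum of the
    L_l.  On the other hand the points not covered at level l e have, up to a set
    of small measure, lower density at least l e, so e times the sum of the L_l with l > 0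
    is at most the integral of the lower density plus e
    ([level_sum_le_integral]).  This bounds the cost, and, the sum of the L_l
    being finite, it also shows that the cubes cover almost everything
    ([cheap_packing_exists]).  Letting e tend to 0 gives the first inequality.

    The integral of a nonnegative function is the supremum of the integrals of
    the simple functions below it, so it is monotone in the integrand, measurable
    or not, and dominates its lower sums over measurable sets.  The second
    inequality follows, since the lower density is at most the upper one. *)

Set Implicit Arguments.
Unset Strict Implicit.

(** * Lebesgue measure of boxes and cubes *)

Section boxes.
Context {R : realType}.

Lemma measurable_box k (A : 'I_k -> set (measurableTypeR R)) :
  (forall i, measurable (A i)) ->
  measurable [set x : euclid R k | forall i, A i (tnth x i)].
Proof.
move=> mA.
rewrite (_ : [set _ | _] = \bigcap_(i in [set: 'I_k]) ((@tnth k _)^~ i @^-1` A i)).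
  apply: fin_bigcap_measurable => // i _.
  by rewrite -[X in measurable X]setTI; exact: measurable_tnth.
by apply/seteqP; split=> x /= Hx i; [move=> _|]; exact: Hx.
Qed.

(** By induction on the dimension: cutting off the first coordinate turns the box
    into a product, whose measure is a product. *)
Lemma lebesgue_tuple_box k (A : 'I_k -> set (measurableTypeR R)) :
  (forall i, measurable (A i)) ->
  lebesgue_tuple k [set x | forall i, A i (tnth x i)] =
  \prod_(i < k) lebesgue_measure (A i).
Proof.
elim: k A => [|k IHk] A mA.
  by rewrite big_ord0 /= diracE mem_set //= => -[].
rewrite big_ord_recl /= -IHk //.
have mB : measurable [set t : euclid R k | forall i, A (lift ord0 i) (tnth t i)].
  by apply: (@measurable_box _ (fun i => A (lift ord0 i))) => i; exact: mA.
rewrite -product_measure1E //.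
rewrite /lebesgue_cons /pushforward; congr (_ _).
apply/seteqP; split=> -[x t] /=.
  move=> H; split; first by have := H ord0.
  by move=> i; have := H (lift ord0 i); rewrite tnthS.
move=> [H0 H] i; case: (unliftP ord0 i) => [j ->|->]; last by [].
by rewrite tnthS; exact: H.
Qed.

Definition closed_cube k (a : euclid R k) (d : R) : set (euclid R k) :=
  [set x | forall i, (tnth a i <= tnth x i <= tnth a i + d)%R].

Section cubes.
Variables (k : nat) (a : euclid R k) (d : R) (lo hi : 'I_k -> bool).
Let side i := Interval (BSide (lo i) (tnth a i)) (BSide (hi i) (tnth a i + d)%R).
Let cube := [set x : euclid R k | forall i, tnth x i \in side i].

Lemma measurable_cube : measurable cube.
Proof. by apply: (@measurable_box _ (fun i => [set` side i])) => i; exact: measurable_itv. Qed.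

(** Whether endpoints belong to the cube does not affect its volume; this is what
    makes the boundaries of cubes negligible below. *)
Lemma lebesgue_tuple_cube : (0 < d)%R -> lebesgue_tuple k cube = (d ^+ k)%:E.
Proof.
move=> d0; rewrite (@lebesgue_tuple_box _ (fun i => [set` side i])); last first.
  by move=> i; exact: measurable_itv.
under eq_bigr => i _.
  rewrite lebesgue_measure_itv /= lte_fin ltrDl d0 -EFinB addrAC subrr add0r; over.
by rewrite prodEFin prodr_const card_ord.
Qed.

End cubes.

Lemma open_cubeE k (a : euclid R k) d : open_cube a d = [set x | forall i, tnth x i \in
  Interval (BSide false (tnth a i)) (BSide true (tnth a i + d)%R)].
Proof. by apply/seteqP; split=> x /= H i; have := H i; rewrite in_itv. Qed.

Lemma closed_cubeE k (a : euclid R k) d : closed_cube a d = [set x | forall i, tnth x i \in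
  Interval (BSide true (tnth a i)) (BSide false (tnth a i + d)%R)].
Proof. by apply/seteqP; split=> x /= H i; have := H i; rewrite in_itv. Qed.

Lemma measurable_open_cube k (a : euclid R k) d : measurable (open_cube a d).
Proof. by rewrite open_cubeE; exact: measurable_cube. Qed.

Lemma measurable_closed_cube k (a : euclid R k) d : measurable (closed_cube a d).
Proof. by rewrite closed_cubeE; exact: measurable_cube. Qed.

Lemma lebesgue_tuple_open_cube k (a : euclid R k) d : (0 < d)%R ->
  lebesgue_tuple k (open_cube a d) = (d ^+ k)%:E.
Proof. by rewrite open_cubeE; exact: lebesgue_tuple_cube. Qed.

Lemma lebesgue_tuple_closed_cube k (a : euclid R k) d : (0 < d)%R ->
  lebesgue_tuple k (closed_cube a d) = (d ^+ k)%:E.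
Proof. by rewrite closed_cubeE; exact: lebesgue_tuple_cube. Qed.

Lemma open_cube_sub_closed k (a : euclid R k) d : open_cube a d `<=` closed_cube a d.
Proof. by move=> x Hx i; have /andP[/ltW-> /ltW->] := Hx i. Qed.

End boxes.

(** * Open sets and a countable family of cubes *)

Lemma bigcup_seq_cons (I : eqType) T (F : I -> set T) h (s : seq I) :
  \bigcup_(j in [set` h :: s]) F j = F h `|` \bigcup_(j in [set` s]) F j.
Proof.
rewrite -bigcup_setU1; congr (bigcup _ _); apply/seteqP; split=> j /=; rewrite inE.
  by move=> /orP[/eqP->|?]; [left|right].
by move=> [->|->]; rewrite ?eqxx ?orbT.
Qed.

Section coordinate_open.
Context {R : realType} {k : nat}.
Local Open Scope ring_scope.

(** Openness for the sup norm, whose balls are cubes; it is the usual topology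
    of R^k. *)
Definition coordinate_open (W : set (euclid R k)) := forall x, W x ->
  exists2 e : R, 0 < e & forall y, (forall i, `|tnth x i - tnth y i| < e) -> W y.

Lemma coordinate_open_cube (a : euclid R k) d : coordinate_open (open_cube a d).
Proof.
move=> x xC.
pose g (i : 'I_k) := Num.min (tnth x i - tnth a i) (tnth a i + d - tnth x i).
exists (\big[Num.min/1]_(i < k) g i).
  apply: lt_bigmin => // i _; rewrite /g lt_min !subr_gt0; exact: xC.
move=> y xy i; have := lt_le_trans (xy i) (bigmin_le_cond _ _ (isT : xpredT i)).
rewrite /g lt_min !ltr_norml => /andP[/andP[_ ?] /andP[? _]].
by apply/andP; split; lra.
Qed.

Lemma coordinate_openD_closed_cube W (a : euclid R k) d :
  coordinate_open W -> coordinate_open (W `\` closed_cube a d).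
Proof.
move=> oW x [Wx]; have [e e0 eW] := oW x Wx.
move=> /existsNP[i /negP]; rewrite negb_and -!ltNge => xi.
exists (Num.min e (if tnth x i < tnth a i then tnth a i - tnth x i
                   else tnth x i - (tnth a i + d))).
  by rewrite lt_min e0 /=; case: ifPn xi => //= xa; rewrite subr_gt0.
move=> y xy; split.
  by apply: eW => l; have := xy l; rewrite lt_min => /andP[].
move=> /(_ i) /andP[ay ya]; have := xy i; rewrite lt_min => /andP[_].
by case: ifPn xi => xi ?; rewrite ltr_norml => /andP[] *; lra.
Qed.

Lemma coordinate_openD_closed_cubes W (a : nat -> euclid R k) (d : nat -> R)
    (s : seq nat) : coordinate_open W ->
  coordinate_open (W `\` \bigcup_(j in [set` s]) closed_cube (a j) (d j)).
Proof.
elim: s W => [|j s IHs] W oW.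
  by rewrite set_nil bigcup_set0 setD0.
rewrite bigcup_seq_cons -setDDl.
exact/IHs/coordinate_openD_closed_cube.
Qed.

End coordinate_open.

Section rational_cubes.
Context {R : realType} {k : nat}.
Local Open Scope ring_scope.

(** A sequence of cubes that approximates from inside every cube centred at any
    point, each approximating cube containing that point and having a side as close
    as desired to the given one. *)
Definition cube_basis (a : nat -> euclid R k) (d : nat -> R) :=
  (forall j, 0 < d j) /\
  forall x s D, s < D -> 0 < D -> exists j, [/\ s < d j < D,
    open_cube (a j) (d j) x &
    forall y, open_cube (a j) (d j) y -> forall i, `|tnth x i - tnth y i| < D / 2].

(** The cubes with rational corner and rational side.  The side is taken in
    ]max(s, D/2), D[; being larger than D/2, the cube can contain x and still fit
    in the cube of side D centred at x. *)
Lemma cube_basis_exists : exists a d, cube_basis a d.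
Proof.
pose code j : option (k.-tuple rat * rat) := unpickle j.
exists (fun j => if code j is Some p then [tuple ratr (tnth p.1 i) | i < k]
                 else [tuple 0 | i < k]).
exists (fun j => if code j is Some p then if 0 < p.2 then ratr p.2 else 1 else 1).
split=> [j|x s D sD D0].
  by case: code => // p; case: ifPn => //; rewrite ltr0q.
have [q /[!in_itv]/= /andP[]] : exists q, ratr q \in `]Num.max s (D / 2), D[.
  by apply: rat_in_itvoo; rewrite gt_max sD /=; lra.
rewrite gt_max => /andP[sq Dq] qD.
have q0 : 0 < q by rewrite -(ltr0q R); lra.
have /choice[p pP] : forall i : 'I_k, exists p, ratr p \in
    `](tnth x i - D / 2), (tnth x i + D / 2 - ratr q)[.
  by move=> i; apply: rat_in_itvoo; lra.
exists (pickle ([tuple p i | i < k], q)).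
rewrite /code pickleK /= q0; split; first by rewrite sq.
  move=> i; rewrite !tnth_mktuple; have := pP i; rewrite in_itv /=.
  by move=> /andP[? ?]; apply/andP; split; lra.
move=> y yC i; have := yC i; have := pP i; rewrite !tnth_mktuple in_itv /=.
by move=> /andP[? ?] /andP[? ?]; rewrite ltr_norml; apply/andP; split; lra.
Qed.

End rational_cubes.

(** * Vitali coverings by cubes *)

Definition volume {R : realType} (k : nat) (d : nat -> R) (t : seq nat) : R :=
  (\sum_(j <- t) d j ^+ k)%R.

Section vitali.
Context {R : realType} {k : nat}.
Variables (a : nat -> euclid R k) (d : nat -> R).
Hypothesis d_gt0 : forall j, (0 < d j)%R.
Local Notation C j := (open_cube (a j) (d j)).
Local Notation mu := (@lebesgue_tuple R k).

Definition packing (W : set (euclid R k)) (t : seq nat) :=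
  [/\ uniq t, trivIset [set` t] (fun j => C j) & forall j, j \in t -> C j `<=` W].

Lemma measurable_cubes (D : set nat) : measurable (\bigcup_(j in D) C j).
Proof. by apply: bigcup_measurable => j _; exact: measurable_open_cube. Qed.

Lemma packing_volume W t :
  packing W t -> mu (\bigcup_(j in [set` t]) C j) = (volume k d t)%:E.
Proof.
move=> [ut tt _]; rewrite measure_fin_bigcup //; [|exact: finite_seq|]; last first.
  by move=> j _; exact: measurable_open_cube.
rewrite -fsbig_seq // /volume -sumEFin; apply: eq_bigr => j _.
exact: lebesgue_tuple_open_cube.
Qed.

Lemma open_cube_neq0 j : C j !=set0.
Proof.
exists [tuple (tnth (a j) i + d j / 2)%R | i < k] => i.
by rewrite tnth_mktuple; have := d_gt0 j => ?; apply/andP; split; lra.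
Qed.

(** Removing the closed cubes keeps the remaining set open, while the new cubes
    only have to avoid the open ones. *)
Lemma packing_cat W s t : packing W s ->
  packing (W `\` \bigcup_(j in [set` s]) closed_cube (a j) (d j)) t ->
  packing W (s ++ t).
Proof.
move=> [us ts sW] [ut tt tW].
have st i j x : i \in s -> j \in t -> C i x -> C j x -> False.
  move=> si tj /open_cube_sub_closed ix /(tW _ tj)[_]; apply.
  by exists i.
split.
- rewrite cat_uniq us ut andbT; apply/hasPn => j tj; apply/negP => sj.
  by have [x jx] := open_cube_neq0 j; exact: (st j j x).
- move=> i j /=; rewrite !mem_cat => /orP[si|ti] /orP[sj|tj] [x [ix jx]].
  + by apply: ts => //; exists x.
  + by case: (st i j x).
  + by case: (st j i x).
  + by apply: tt => //; exists x.
- by move=> j; rewrite mem_cat => /orP[/sW//|/tW jW x /jW[]].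
Qed.

Let triple j := open_cube [tuple (tnth (a j) i - d j)%R | i < k] (3 * d j)%R.

(** Scan the cubes by decreasing side and keep those that avoid the ones already
    kept: a rejected cube meets a kept cube that is at least as large, hence lies
    in its concentric triple. *)
Lemma vitali_selection (s : seq nat) : exists t,
  [/\ {subset t <= s}, uniq t, trivIset [set` t] (fun j => C j) &
      \bigcup_(j in [set` s]) C j `<=` \bigcup_(j in [set` t]) triple j].
Proof.
have sub3 i j : (d i <= d j)%R -> C i `&` C j !=set0 -> C i `<=` triple j.
  move=> ij [x [ix jx]] y iy l; rewrite tnth_mktuple.
  have := ix l; have := jx l; have := iy l.
  by move=> /andP[? ?] /andP[? ?] /andP[? ?]; apply/andP; split; lra.
wlog : s / sorted (relpre d <=%R) s.
  move=> /(_ (sort (relpre d <=%R) s)) [|t [ts ut tt st]].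
    by apply: sort_sorted => i j; exact: le_total.
  exists t; split=> // [j /ts|x [j /= js]]; first by rewrite mem_sort.
  by move=> jx; apply: st; exists j => //=; rewrite mem_sort.
elim: s => [_|h s IHs hs]; first by exists [::]; split=> // x [].
have [|t [ts ut tt st]] := IHs; first exact: path_sorted hs.
have /allP hmin : all (relpre d <=%R h) s.
  by apply: order_path_min hs => ? ? ?; exact: le_trans.
have [[j /= tj hj]|nh] := pselect (exists2 j, j \in t & C h `&` C j !=set0).
  exists t; split=> // [i /ts|]; first by rewrite inE orbC => ->.
  rewrite bigcup_seq_cons => x [hx|/st//].
  by exists j => //; apply: sub3 hx => //; exact/hmin/ts.
have ht j : j \in t -> C h `&` C j !=set0 -> h = j by move=> tj hj; case: nh; exists j.
exists (h :: t); split.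
- by move=> j; rewrite !inE => /orP[->//|/ts->]; rewrite orbT.
- rewrite /= ut andbT; apply/negP => th; apply: nh; exists h => //.
  by rewrite setIid; exact: open_cube_neq0.
- move=> i j /=; rewrite !inE => /orP[/eqP->|ti] /orP[/eqP->|tj] // ij.
  + exact: ht.
  + by apply/esym/ht => //; rewrite setIC.
  + exact: tt.
- rewrite !bigcup_seq_cons; apply: setUSS => // x hx i.
  rewrite tnth_mktuple; have := hx i; have := d_gt0 h => ? /andP[? ?].
  by apply/andP; split; lra.
Qed.

Lemma mu_triple j : mu (triple j) = (3 ^+ k * d j ^+ k)%:E.
Proof. by rewrite lebesgue_tuple_open_cube ?mulr_gt0 // exprMn. Qed.

(** As the family is countable, finitely many of its cubes already cover [E] up
    to measure [e]; continuity of the measure replaces compactness.  The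
    selection lemma applies to these. *)
Lemma vitali_step (P : set nat) E (e : R) : (0 < e)%R -> measurable E ->
  mu E < +oo -> E `<=` \bigcup_(j in P) C j -> exists t,
  [/\ forall j, j \in t -> P j, uniq t, trivIset [set` t] (fun j => C j) &
     mu E <= (3 ^+ k * volume k d t + e)%:E].
Proof.
move=> e0 mE Eoo EP.
pose F N := E `&` \bigcup_(j in [set j | (j < N)%N /\ P j]) C j.
have mF N : measurable (F N) by apply: measurableI => //; exact: measurable_cubes.
have EF : E = \bigcup_N F N.
  apply/seteqP; split=> [x Ex|x [N _ []//]].
  by have [j Pj jx] := EP x Ex; exists j.+1 => //; split=> //; exists j.
have ndF : nondecreasing_seq F.
  move=> M N MN; apply/subsetPset => x [Ex [j /= [jM Pj] jx]]; split=> //.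
  by exists j => //; split=> //; exact: leq_trans MN.
have Efin : mu E \is a fin_num by rewrite ge0_fin_numE.
have muE : mu E = ereal_sup (range (mu \o F)).
  have muF : mu \o F @ \oo --> mu E.
    by rewrite [in mu E]EF; apply: nondecreasing_cvg_mu => //; rewrite -EF.
  rewrite -(cvg_lim _ muF) //; apply/cvg_lim => //.
  apply: ereal_nondecreasing_cvgn => M N MN.
  by apply: le_measure; rewrite ?inE//; exact/subsetPset/ndF.
have [|_ [N _ <-]] := @ub_ereal_sup_adherent _ (range (mu \o F)) e e0; first by rewrite -muE.
rewrite -muE /= => EN.
have [t [ts ut tt st]] := vitali_selection [seq j <- iota 0 N | `[< P j >]].
exists t; split=> // [j /ts|]; first by rewrite mem_filter => /andP[/asboolP].
rewrite EFinD -leeBlDr // ltW // (lt_le_trans EN) //.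
apply: (@le_trans _ _ (\sum_(j \in [set` t]) mu (triple j))).
  apply: content_sub_fsum => //; first exact: finite_seq.
    by move=> j _; exact: measurable_open_cube.
  move=> x [Ex [j /= [jN Pj] jx]]; apply: st; exists j => //=.
  by rewrite mem_filter mem_iota jN asboolT.
rewrite -fsbig_seq // /volume mulr_sumr -sumEFin; apply: lee_sum => j _.
by rewrite mu_triple.
Qed.

(** The points at which the cubes with index in [P] form a fine cover. *)
Definition vitali_limit (P : set nat) : set (euclid R k) :=
  [set x | forall e, (0 < e)%R -> exists j, [/\ P j, (d j < e)%R & C j x]].

Lemma measurable_vitali_limit P : measurable (vitali_limit P).
Proof.
rewrite (_ : vitali_limit P = \bigcap_n
    \bigcup_(j in [set j | P j /\ (d j < n.+1%:R^-1)%R]) C j).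
  by apply: bigcap_measurable => // n _; exact: measurable_cubes.
apply/seteqP; split=> [x xP n _|x xP e e0].
  have [|j [Pj jn jx]] := xP n.+1%:R^-1%R; first by rewrite invr_gt0.
  by exists j.
have [n ne] : exists n : nat, (n.+1%:R^-1 < e)%R.
  exists (Num.truncn e^-1); rewrite invf_plt ?posrE //; exact: truncnS_gt.
by have [j /= [Pj jn] jx] := xP n Logic.I; exists j; split=> //; exact: lt_trans ne.
Qed.

(** Among the extensions [t] of the packing [s] by cubes of [P], take one whose
    volume is almost maximal.  What remains of the open set [W] is open, so its
    points of [vitali_limit P] lie in cubes of [P] contained in it; if they had
    measure more than [e], [vitali_step] would add too much volume. *)
Lemma vitali_packing (P : set nat) W s (e : R) : (0 < e)%R ->
  coordinate_open W -> measurable W -> mu W < +oo -> packing W s ->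
  exists t, [/\ packing W (s ++ t), forall j, j \in t -> P j &
    mu ((W `&` vitali_limit P) `\` \bigcup_(j in [set` s ++ t]) C j) <= e%:E].
Proof.
move=> e0 oW mW Woo sW.
pose S := [set volume k d t | t in [set t | packing W (s ++ t) /\ forall j, j \in t -> P j]].
have supS : has_sup S.
  split; first by exists (volume k d [::]), [::] => //; split=> //; rewrite cats0.
  exists (fine (mu W)) => _ [t [tW _] <-].
  apply: (@le_trans _ _ (volume k d (s ++ t))).
    by rewrite /volume big_cat lerDr sumr_ge0 // => j _; rewrite exprn_ge0 // ltW.
  rewrite -lee_fin fineK ?ge0_fin_numE // -(packing_volume tW).
  apply: le_measure; rewrite ?inE //; first exact: measurable_cubes.
  by have [_ _ stW] := tW => x [j tj]; exact: stW.
have k0 : (0 < 3 ^+ k :> R)%R by rewrite exprn_gt0.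
have [_ [t [tW tP] <-] tS] := sup_adherent (divr_gt0 (divr_gt0 e0 (ltr0n _ 2)) k0) supS.
exists t; split=> //.
set u := s ++ t in tW *; set W' := W `\` \bigcup_(j in [set` u]) closed_cube (a j) (d j).
have oW' : coordinate_open W' by exact: coordinate_openD_closed_cubes.
have mW' : measurable W'.
  by apply: measurableD => //; apply: bigcup_measurable => j _; exact: measurable_closed_cube.
have mL := measurable_vitali_limit P.
have mE : measurable (W' `&` vitali_limit P) by exact: measurableI.
have Eoo : mu (W' `&` vitali_limit P) < +oo.
  apply: le_lt_trans Woo; apply: le_measure; rewrite ?inE // => x [[]//].
have mC D := measurable_cubes D.
apply: (@le_trans _ _ (mu (W' `&` vitali_limit P))).
  (* the boundaries of the chosen cubes *)
  pose N := \bigcup_(j in [set` u]) (closed_cube (a j) (d j) `\` C j).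
  have mN j : measurable (closed_cube (a j) (d j) `\` C j).
    by apply: measurableD; [exact: measurable_closed_cube|exact: measurable_open_cube].
  have mN' : measurable N by apply: bigcup_measurable => j _; exact: mN.
  have N0 : mu N = 0.
    apply/eqP; rewrite eq_le measure_ge0 andbT.
    apply: (@le_trans _ _ (\sum_(j \in [set` u]) mu (closed_cube (a j) (d j) `\` C j))).
      by apply: content_sub_fsum => //; exact: finite_seq.
    rewrite fsbig1 // => j _.
    have cC : C j `<=` closed_cube (a j) (d j) by exact: open_cube_sub_closed.
    have [mc mo] := (measurable_closed_cube (a j) (d j), measurable_open_cube (a j) (d j)).
    have muc := lebesgue_tuple_closed_cube (a j) (d_gt0 j).
    have moo : mu (closed_cube (a j) (d j)) < +oo by rewrite muc ltry.
    have mu0 : mu (closed_cube (a j) (d j)) - mu (C j) = 0.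
      by rewrite muc lebesgue_tuple_open_cube // subee.
    by rewrite measureD ?setIidr.
  rewrite -[leRHS]adde0 -N0 (le_trans _ (measureU2 _ _ _)) //.
  apply: le_measure; rewrite ?inE //; first by apply: measurableD => //; exact: measurableI.
    exact: measurableU.
  move=> x [[Wx xL] nx].
  have [[j tj jx]|nc] := pselect ((\bigcup_(j in [set` u]) closed_cube (a j) (d j)) x).
    by right; exists j => //; split=> // Cx; apply: nx; exists j.
  by left.
have [|t' [t'P ut' tt' Et']] := @vitali_step [set j | P j /\ C j `<=` W'] _ _
    (divr_gt0 e0 (ltr0n _ 2)) mE Eoo.
  move=> x [/oW'[r r0 rW'] /(_ r r0)[j [Pj jr jx]]]; exists j => //; split=> // y jy.
  apply: rW' => i; have := jx i; have := jy i => /andP[? ?] /andP[? ?].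
  by rewrite ltr_norml; apply/andP; split; lra.
apply: le_trans Et' _; rewrite lee_fin.
have t't : S (volume k d (t ++ t')).
  exists (t ++ t') => //; split.
    by rewrite catA -/u; apply: packing_cat => //; split=> // j /t'P[].
  by move=> j; rewrite mem_cat => /orP[/tP//|/t'P[]].
have := sup_ubound supS.2 t't; rewrite /volume big_cat /= -/(volume k d t) -/(volume k d t').
move=> tt'S; have {tt'S} : (volume k d t' <= e / 2 / 3 ^+ k)%R by lra.
by rewrite ler_pdivlMr // mulrC => ?; lra.
Qed.

End vitali.

(** * Euclidean balls and Hausdorff content *)

Section euclidean_ball.
Context {R : realType}.
Local Open Scope ring_scope.

Lemma edist_lt k (x y : euclid R k) (s : R) : (0 < k)%N ->
  (forall i, `|tnth x i - tnth y i| < s)%R -> (Defs.edist x y < Num.sqrt k%:R * s)%R.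
Proof.
move=> k0 xys; have s0 : (0 < s)%R by exact: le_lt_trans (xys (Ordinal k0)).
rewrite -[s]gtr0_norm // -sqrtr_sqr -sqrtrM // ltr_sqrt; last first.
  by rewrite mulr_gt0 ?exprn_gt0 ?ltr0n.
have -> : (k%:R * s ^+ 2 = \sum_(i < k) s ^+ 2)%R.
  by rewrite sumr_const card_ord mulr_natl.
apply: ltr_sum => [|i _].
  by apply/hasP; exists (Ordinal k0) => //; exact: mem_index_enum.
by rewrite -[(tnth x i - tnth y i) ^+ 2]real_normK ?num_real // ltr_pXn2r // nnegrE ?ltW.
Qed.

Lemma le_edist k (x y : euclid R k) i : (`|tnth x i - tnth y i| <= Defs.edist x y)%R.
Proof.
rewrite -sqrtr_sqr; apply: ler_wsqrtr; rewrite (bigD1 i) //= lerDl.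
by apply: sumr_ge0 => j _; exact: sqr_ge0.
Qed.

Lemma measurable_eball k (x : euclid R k) r : (0 < r)%R -> measurable (eball x r).
Proof.
move=> r0.
have mg : measurable_fun setT (fun y : euclid R k => \sum_(i < k) (tnth x i - tnth y i) ^+ 2)%R.
  apply: measurable_sum => i; apply: measurable_funX; apply: measurable_funB => //.
  exact: measurable_tnth.
rewrite (_ : eball x r = (fun y : euclid R k => \sum_(i < k) (tnth x i - tnth y i) ^+ 2)%R
    @^-1` `]-oo, (r ^+ 2)%R[).
  by rewrite -[X in measurable X]setTI; apply: mg => //; exact: measurable_itv.
apply/seteqP; split=> y /=; rewrite /eball /= in_itv /= /Defs.edist.
  by rewrite -[X in _ < X -> _]gtr0_norm // -sqrtr_sqr ltr_sqrt // exprn_gt0.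
by rewrite -[X in _ -> _ < X]gtr0_norm // -sqrtr_sqr ltr_sqrt // exprn_gt0.
Qed.

(** The unit ball contains a cube and is contained in a cube; the upper bound
    matters because [omega] would be 0 if the volume were infinite. *)
Lemma omega_gt0 n : (0 < n)%N -> (0 < omega n :> R)%R.
Proof.
move=> n0; set o := [tuple 0%R : R | _ < n].
have mB : measurable (eball o 1%R) by exact: measurable_eball.
have q0 : (0 < Num.sqrt n%:R :> R)%R by rewrite sqrtr_gt0 ltr0n.
pose s : R := ((Num.sqrt n%:R)^-1)%R.
have s0 : (0 < s)%R by rewrite invr_gt0.
apply: fine_gt0; apply/andP; split.
  have d0 : (0 < 2 * s)%R by rewrite mulr_gt0.
  apply: (@lt_le_trans _ _ (lebesgue_tuple n (open_cube [tuple - s | _ < n] (2 * s)%R))).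
    by rewrite lebesgue_tuple_open_cube // lte_fin exprn_gt0.
  apply: le_measure; rewrite ?inE //; first exact: measurable_open_cube.
  move=> y yC; rewrite /eball /= -(divff (lt0r_neq0 q0)); apply: edist_lt => // i.
  have := yC i; rewrite !tnth_mktuple => /andP[? ?].
  by rewrite ltr_norml; apply/andP; split; rewrite -/s; lra.
apply: (@le_lt_trans _ _ (lebesgue_tuple n (closed_cube [tuple (-1)%R | _ < n] 2%R))).
  apply: le_measure; rewrite ?inE //; first exact: measurable_closed_cube.
  move=> y yB i; have := le_lt_trans (le_edist o y i) yB.
  by rewrite !tnth_mktuple ltr_norml => /andP[? ?]; apply/andP; split; lra.
by rewrite lebesgue_tuple_closed_cube // ltry.
Qed.

End euclidean_ball.

Section hausdorff_content.
Context {R : realType} {X : metricType R}.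

Lemma hausdorff_content_ge0 n (E : set X) : 0 <= hausdorff_content n E.
Proof.
apply: le_ereal_inf_tmp => _ [A _ <-]; apply: mule_ge0.
  by rewrite lee_fin divr_ge0 ?exprn_ge0 // fine_ge0.
by apply: nneseries_ge0 => i _ _; apply: expe_ge0; apply: ereal_sup_ubound; left.
Qed.

Lemma le_hausdorff_content n (E F : set X) : E `<=` F ->
  hausdorff_content n E <= hausdorff_content n F.
Proof.
move=> EF; apply: ereal_inf_le_tmp => _ [A FA <-]; exists A => //.
exact: subset_trans FA.
Qed.

End hausdorff_content.

(** * Lower sums for the integral *)

Section lower_integral.
Context d (T : measurableType d) (R : realType) (mu : {measure set T -> \bar R}).

(** The integral is a supremum over the simple functions below the integrand. *)
Lemma ge0_le_integral_nonmeasurable D (f g : T -> \bar R) :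
  (forall x, D x -> 0 <= f x) -> (forall x, D x -> f x <= g x) ->
  \int[mu]_(x in D) f x <= \int[mu]_(x in D) g x.
Proof.
move=> f0 fg; have g0 x : D x -> 0 <= g x by move=> Dx; exact: le_trans (f0 x Dx) (fg x Dx).
rewrite !ge0_integralE //; apply: ereal_sup_le. move=> _ [h hf <-]. exists h => //= x.
apply: le_trans (hf x) _; rewrite /patch; case: ifPn => // /set_mem; exact: fg.
Qed.

(** At a point of [A l] with [l] maximal, at most [l.+1] of the summands [e * \1_(A i)]
    are nonzero, and [f] is at least [l.+1 * e] there. *)
Lemma level_sum_le_integral (Q : set T) (f : T -> \bar R) (A : nat -> set T) (e : R) N :
  (0 <= e)%R -> measurable Q -> (forall x, Q x -> 0 <= f x) ->
  (forall l, measurable (A l)) -> (forall l, A l `<=` Q) ->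
  (forall l x, A l x -> (l.+1%:R * e)%:E <= f x) ->
  \sum_(0 <= l < N) e%:E * mu (A l) <= \int[mu]_(x in Q) f x.
Proof.
move=> e0 mQ f0 mA AQ Af.
have intA l : e%:E * mu (A l) = \int[mu]_(x in Q) (e%:E * (\1_(A l) x)%:E).
  rewrite ge0_integralZl_EFin //; last first.
    by apply/measurable_EFinP; exact: measurable_indic.
  by rewrite integral_indic // setIidl.
rewrite (eq_bigr _ (fun l _ => intA l)) -ge0_integral_sum //; last 2 first.
- by move=> l; apply/measurable_EFinP; apply: measurable_funM => //; exact: measurable_indic.
- by move=> l x _; rewrite -EFinM lee_fin mulr_ge0.
apply: ge0_le_integral_nonmeasurable => [x _|x Qx].
  by apply: sume_ge0 => l _; rewrite -EFinM lee_fin mulr_ge0.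
(* pointwise: either [A N] does not contribute, or [f x] dominates all terms *)
elim: N => [|N IHN]; first by rewrite big_geq //; exact: f0.
rewrite big_nat_recr //=; have [xN|xN] := pselect (A N x); last first.
  by rewrite indicE memNset // mule0 adde0.
apply: le_trans (Af _ _ xN).
have -> : (N.+1%:R * e)%:E = \sum_(0 <= l < N.+1) e%:E.
  by rewrite sumEFin sumr_const_nat subn0 mulr_natl.
rewrite big_nat_recr //= leeD //.
  by apply: lee_sum => l _; rewrite -EFinM lee_fin ler_piMr // indicE lern1 leq_b1.
by rewrite -EFinM lee_fin ler_piMr // indicE lern1 leq_b1.
Qed.

End lower_integral.

(** * Packings of small total cost *)

Section cheap_packing.
Context {R : realType} {k : nat}.
Variables (a : nat -> euclid R k) (d : nat -> R).
Hypothesis d_gt0 : forall j, (0 < d j)%R.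
Local Notation C j := (open_cube (a j) (d j)).
Local Notation mu := (@lebesgue_tuple R k).
Variables (Q W : set (euclid R k)) (theta : euclid R k -> \bar R).
Variables (K : R) (g : nat -> \bar R).
Hypotheses (mQ : measurable Q) (mW : measurable W) (oW : coordinate_open W).
Hypotheses (WQ : W `<=` Q) (Woo : mu W < +oo).
Hypotheses (theta0 : forall x, Q x -> 0 <= theta x).
Hypotheses (K0 : (0 <= K)%R) (g0 : forall j, 0 <= g j).

(** The index of a cube of cost [g j] at most [K * q] times its volume. *)
Definition cheap (q : R) := [set j | g j <= (K * q * d j ^+ k)%:E].

Hypothesis thetaP : forall q x, W x -> theta x < q%:E -> vitali_limit a d (cheap q) x.

(** Stage [l.+1] uses only cubes that are cheap at level [l.+1 * e], starting from
    the packing of stage [l].  What it leaves uncovered is, up to [2^-(l+1)], the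
    set of points with no fine cover by such cubes. *)
Lemma cheap_packing_sequence (e : R) : (0 < e)%R -> exists t : nat -> seq nat,
  t 0%N = [::] /\ forall l, exists s,
  [/\ t l.+1 = t l ++ s, packing a d W (t l.+1),
      forall j, j \in s -> cheap (l.+1%:R * e) j &
      mu (W `\` \bigcup_(j in [set` t l.+1]) C j) <=
      mu (W `\` vitali_limit a d (cheap (l.+1%:R * e))) + (2^-1 ^+ l.+1)%:E].
Proof.
move=> e0.
have step (l : nat) (u : seq nat) : exists s, packing a d W u ->
    [/\ packing a d W (u ++ s), forall j, j \in s -> cheap (l.+1%:R * e) j &
    mu ((W `&` vitali_limit a d (cheap (l.+1%:R * e))) `\`
         \bigcup_(j in [set` u ++ s]) C j) <= (2^-1 ^+ l.+1)%:E].
  have [pu|npu] := pselect (packing a d W u); last by exists [::].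
  have e20 : (0 < 2^-1 ^+ l.+1 :> R)%R by rewrite exprn_gt0.
  by have [s] := vitali_packing d_gt0 (cheap (l.+1%:R * e)) e20 oW mW Woo pu; exists s.
have [F FP] := choice (fun p : nat * seq nat => step p.1 p.2).
pose fix t (l : nat) : seq nat := if l is l'.+1 then t l' ++ F (l', t l') else [::].
have pt l : packing a d W (t l).
  elim: l => [|l IHl]; first by split=> // i j; rewrite /= in_nil.
  by have [] := FP (l, t l) IHl.
exists t; split=> // l; exists (F (l, t l)); have [? ? le] := FP (l, t l) (pt l); split=> //.
set L := vitali_limit _ _ _ in le *.
have mL : measurable L by exact: measurable_vitali_limit.
have mC : measurable (\bigcup_(j in [set` t l.+1]) C j) by exact: measurable_cubes.
rewrite (le_trans _ (leeD (lexx _) le)) // (le_trans _ (measureU2 _ _ _)) //.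
- apply: le_measure; rewrite ?inE.
  + exact: measurableD.
  + by apply: measurableU; apply: measurableD => //; exact: measurableI.
  + by move=> x [Wx nx]; have [Lx|nL] := pselect (L x); [right|left].
- exact: measurableD.
- by apply: measurableD => //; exact: measurableI.
Qed.

(** Let [v l] be the volume covered at stage [l] and [V] that of [W].  Since
    the cubes of stage [l.+1] cost [K * e] times [l.+1] times their volume,
    summation by parts bounds the cost at stage [N] by [K * e] times the sum over
    [l < N] of [v N - v l].  The sum of the leftovers [V - v l] is in turn bounded
    by the integral ([main] in the proof). *)
Lemma cheap_packing_exists (e : R) : (0 < e)%R ->
  \int[mu]_(x in Q) theta x < +oo -> exists J : set nat,
  [/\ trivIset J (fun j => C j), forall j, J j -> C j `<=` W,
     mu (W `\` \bigcup_(j in J) C j) = 0 &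
     \esum_(j in J) g j <=
       K%:E * (\int[mu]_(x in Q) theta x + (e * (fine (mu W) + 1))%:E)].
Proof.
move=> e0 Ioo; have [t [t0 tS]] := cheap_packing_sequence e0.
have pt l : packing a d W (t l).
  case: l => [|l]; last by have [s []] := tS l.
  by rewrite t0; split=> // i j; rewrite /= in_nil.
have tsub l l' : (l <= l')%N -> {subset t l <= t l'}.
  move=> ll' j tj; rewrite -(subnKC ll'); elim: (l' - l)%N => [|i IHi]; first by rewrite addn0.
  by rewrite addnS; have [s [-> _ _ _]] := tS (l + i)%N; rewrite mem_cat IHi.
have I0 : 0 <= \int[mu]_(x in Q) theta x by exact: integral_ge0.
have Ifin : \int[mu]_(x in Q) theta x \is a fin_num by rewrite ge0_fin_numE.
have Wfin : mu W \is a fin_num by rewrite ge0_fin_numE.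
set I := \int[mu]_(x in Q) theta x in I0 Ifin Ioo *.
pose V := fine (mu W); pose v l := volume k d (t l).
have VE : mu W = V%:E by rewrite fineK.
have v0 : v 0%N = 0%R by rewrite /v t0 /volume big_nil.
have mC l : measurable (\bigcup_(j in [set` t l]) C j) by exact: measurable_cubes.
have tW l : \bigcup_(j in [set` t l]) C j `<=` W.
  by move=> x [j tj jx]; have [_ _ /(_ j tj)] := pt l; exact.
have leftover l : mu (W `\` \bigcup_(j in [set` t l]) C j) = (V - v l)%:E.
  have vE := packing_volume d_gt0 (pt l).
  have voo : mu W - mu (\bigcup_(j in [set` t l]) C j) = (V - v l)%:E by rewrite vE VE.
  by rewrite measureD ?setIidr.
have vV l : (v l <= V)%R by rewrite -subr_ge0 -lee_fin -leftover measure_ge0.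
(* the points missed at stage [l.+1] have [theta] at least [l.+1 * e], so the
   leftovers form a lower sum for the integral *)
have main N : (e * \sum_(0 <= l < N) (V - v l.+1) <= fine I + e)%R.
  rewrite -lee_fin EFinD fineK //.
  pose A l := W `\` vitali_limit a d (cheap (l.+1%:R * e)).
  have mA l : measurable (A l) by apply: measurableD => //; exact: measurable_vitali_limit.
  have lI : \sum_(0 <= l < N) e%:E * mu (A l) <= I.
    apply: level_sum_le_integral => //; first exact: ltW.
    - by move=> l x [/WQ].
    - by move=> l x [Wx nx]; rewrite leNgt; apply/negP => /(thetaP Wx).
  apply: le_trans (leeD lI (lexx _)).
  apply: (@le_trans _ _ (\sum_(0 <= l < N) (e%:E * mu (A l) + (e * 2^-1 ^+ l.+1)%:E))).
    rewrite mulr_sumr -sumEFin; apply: lee_sum => l _.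
    rewrite EFinM -leftover EFinM -ge0_muleDr //.
    by have [s [_ _ _ ?]] := tS l; rewrite lee_wpmul2l // lee_fin ltW.
  rewrite big_split /= leeD2l // sumEFin -mulr_sumr lee_fin ger_pMr //.
  have -> : (\sum_(0 <= l < N) 2^-1 ^+ l.+1 = 1 - 2^-1 ^+ N :> R)%R.
    elim: N {lI} => [|N IHN]; first by rewrite big_geq // expr0 subrr.
    by rewrite big_nat_recr //= IHN exprS; field.
  by rewrite gerBl exprn_ge0.
have cost N : \sum_(j <- t N) g j <= (K * (e * \sum_(0 <= l < N) (v N - v l)))%:E.
  elim: N => [|N IHN]; first by rewrite t0 big_nil big_geq // !mulr0.
  have [s [tE _ sP _]] := tS N.
  have vN : v N.+1 = (v N + volume k d s)%R by rewrite /v tE /volume big_cat.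
  have gs : \sum_(j <- s) g j <= (K * (N.+1%:R * e) * volume k d s)%:E.
    rewrite /volume mulr_sumr -sumEFin big_seq [leRHS]big_seq.
    by apply: lee_sum => j sj; exact: sP.
  rewrite tE big_cat /= (le_trans (leeD IHN gs)) // -EFinD lee_fin vN le_eqVlt; apply/orP; left.
  have -> : (\sum_(0 <= l < N.+1) (v N + volume k d s - v l) =
      \sum_(0 <= l < N) (v N - v l) + N.+1%:R * volume k d s)%R.
    rewrite big_nat_recr //= -[in LHS]addrAC subrr add0r.
    under eq_bigr do rewrite addrAC.
    by rewrite big_split /= sumr_const_nat subn0 -mulr_natl -natr1; ring.
  by apply/eqP; ring.
exists [set j | exists l, j \in t l]; split.
- move=> i j /= [l il] [l' jl']; have [_ tr _] := pt (maxn l l').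
  by apply: tr => /=; [apply: tsub il; exact: leq_maxl|apply: tsub jl'; exact: leq_maxr].
- by move=> j [l jl]; have [_ _] := pt l; exact.
- set U := \bigcup_(j in _) _; have mU : measurable U by exact: measurable_cubes.
  have roo : mu (W `\` U) < +oo.
    apply: le_lt_trans Woo; apply: le_measure; rewrite ?inE //.
    exact: measurableD.
  have rfin : mu (W `\` U) \is a fin_num by rewrite ge0_fin_numE.
  have rV l : (fine (mu (W `\` U)) <= V - v l)%R.
    rewrite -lee_fin fineK // -leftover; apply: le_measure; rewrite ?inE.
    + exact: measurableD.
    + exact: measurableD.
    + by apply: setDS => x [j tj jx]; exists j => //; exists l.
  apply/eqP; rewrite -[mu _]fineK // eqe eq_le fine_ge0 // andbT leNgt; apply/negP => r0.
  set r := fine _ in r0 rV.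
  (* a positive measure left over by all stages would make the sum of the
     leftovers diverge *)
  have [N Ngt] : exists N : nat, ((fine I + e) / (e * r) < N%:R)%R.
    by exists (Num.truncn ((fine I + e) / (e * r))).+1; exact: truncnS_gt.
  move: Ngt; rewrite ltr_pdivrMr ?mulr_gt0 // ltNge => /negP; apply.
  apply: le_trans (main N); rewrite mulrCA ler_pM2l //.
  have -> : (N%:R * r = \sum_(0 <= l < N) r)%R by rewrite sumr_const_nat subn0 mulr_natl.
  by apply: ler_sum => l _.
- apply: ge_ereal_sup => _ [A [finA AJ] <-].
  have [s As] := (finite_seqP A).1 finA.
  have [N sN] : exists N, {subset s <= t N}.
    have : forall j, j \in s -> exists l, j \in t l by move=> j js; apply: AJ; rewrite As.
    elim: s {As} => [|h s IHs] sJ; first by exists 0%N.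
    have [j js|N sN] := IHs; first by apply: sJ; rewrite inE js orbT.
    have [l hl] := sJ h (mem_head _ _).
    exists (maxn N l) => j; rewrite inE => /orP[/eqP->|/sN].
      by apply: tsub hl; exact: leq_maxr.
    by apply: tsub; exact: leq_maxl.
  have [ut _ _] := pt N.
  apply: (@le_trans _ _ (\sum_(j <- t N) g j)).
    rewrite [leRHS]fsbig_seq //; apply: lee_fsum_nneg_subset => //.
    by move=> j; rewrite !inE As /= => /sN.
  apply: le_trans (cost N) _; rewrite EFinM lee_wpmul2l ?lee_fin //.
  rewrite -[I]fineK // -EFinD lee_fin.
  (* the term [l = 0] is [V], the others are bounded by [main] *)
  case: N {sN ut} => [|N]; first rewrite big_geq // mulr0.
    by rewrite addr_ge0 ?fine_ge0 // mulr_ge0 ?addr_ge0 ?fine_ge0 // ltW.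
  have le1 : (\sum_(0 <= l < N.+1) (v N.+1 - v l) <= V + \sum_(0 <= l < N) (V - v l.+1))%R.
    rewrite big_nat_recl // v0 subr0 lerD // ler_sum // => l _; exact: lerB.
  have := main N; rewrite -/V => mN.
  apply: (@le_trans _ _ (e * (V + \sum_(0 <= l < N) (V - v l.+1)))%R).
    by rewrite ler_pM2l.
  by lra.
Qed.

End cheap_packing.

(** * Lower densities and cheap cubes *)

Lemma limf_einf_le_esup (T : choiceType) (X : filteredType T) (R : realType)
    (f : X -> \bar R) (F : set (set X)) : ProperFilter F ->
  limf_einf f F <= limf_esup f F.
Proof.
move=> FF; rewrite limf_einfE limf_esupE.
apply: ge_ereal_sup => _ [A FA <-]; apply: le_ereal_inf_tmp => _ [B FB <-].
have [x [Ax Bx]] := filter_ex (filterI FA FB).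
by apply: (@le_trans _ _ (f x)); [apply: ereal_inf_lbound|apply: ereal_sup_ubound]; exists x.
Qed.

Definition cube_constant {R : realType} (n k : nat) : R :=
  (omega n / 2 ^+ n * (k%:R `^ (n%:R / 2)))%R.

Section lower_density.
Context {R : realType} {X : metricType R} {k : nat}.
Variables (n : nat) (Q : set (euclid R k)) (f : euclid R k -> X).
Hypotheses (n_gt0 : (0 < n)%N) (k_gt0 : (0 < k)%N).

Lemma lower_density_ge0 x : 0 <= lower_density n Q f x.
Proof.
rewrite /lower_density limf_einfE; apply: le_ereal_sup_tmp.
exists (ereal_inf (density_ratio n Q f x @` [set r | (0 < r)%R])).
  by exists [set r | (0 < r)%R] => //; exact: nbhs_right_gt.
apply: le_ereal_inf_tmp => _ [r /= r0 <-]; apply: mule_ge0; first exact: hausdorff_content_ge0.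
by rewrite lee_fin invr_ge0 mulr_ge0 ?exprn_ge0 ?ltW // omega_gt0.
Qed.

Lemma lower_density_lt x q e : (0 < e)%R -> lower_density n Q f x < q%:E ->
  exists r, (0 < r < e)%R /\
    hausdorff_content n (f @` (eball x r `&` Q)) < (q * (omega n * r ^+ n))%:E.
Proof.
move=> e0; rewrite /lower_density limf_einfE => xq.
have : ereal_inf (density_ratio n Q f x @` [set r | (0 < r < e)%R]) < q%:E.
  apply: le_lt_trans xq; apply: ereal_sup_ubound; exists [set r | (0 < r < e)%R] => //.
  by near=> r; apply/andP; split; near: r; [exact: nbhs_right_gt|exact: nbhs_right_lt].
move=> /ereal_inf_lt[_ [r /= /andP[r0 re] <-]] rq; exists r; rewrite r0 re; split=> //.
by move: rq; rewrite /density_ratio lte_pdivrMr // mulr_gt0 ?exprn_gt0 // omega_gt0.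
Unshelve. all: by end_near. Qed.

Local Notation K := (@cube_constant R n k).

Lemma cube_constant_gt0 : (0 < K)%R.
Proof.
rewrite mulr_gt0 //; first by rewrite divr_gt0 ?omega_gt0 ?exprn_gt0.
by apply: powR_gt0; rewrite ltr0n.
Qed.

(** The cube of side [2 * r / sqrt k] is the one inscribed in the ball of radius [r]. *)
Lemma cube_constantE (r : R) : (K * (2 * r / Num.sqrt k%:R) ^+ n = omega n * r ^+ n)%R.
Proof.
have s0 : Num.sqrt k%:R != 0%R :> R by rewrite gt_eqF // sqrtr_gt0 ltr0n.
rewrite /cube_constant [(n%:R / 2)%R]mulrC powRrM powR12_sqrt ?ler0n // powR_mulrn ?sqrtr_ge0 //.
rewrite !exprMn exprVn; field.
by rewrite !expf_neq0.
Qed.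

(** A ball about [x] of small radius [r] has an image of content less than
    [q * (omega n * r ^+ n)], which is [K * q * D ^+ n] for the side [D] of the inscribed
    cube.  A cube of the basis of side close to [D], containing [x] and contained in
    that inscribed cube, is then still cheap. *)
Lemma lower_density_vitali_limit m a d W q x : cube_basis a d ->
  coordinate_open W -> W `<=` Q -> W x -> lower_density n Q f x < q%:E ->
  vitali_limit a d (cheap (k := n + m) d K
    (fun j => hausdorff_content n (f @` open_cube (a j) (d j)) * (d j ^+ m)%:E) q) x.
Proof.
move=> [d0 basis] oW WQ Wx xq e e0.
have [e1 e10 e1W] := oW x Wx.
have sk : (0 < Num.sqrt k%:R :> R)%R by rewrite sqrtr_gt0 ltr0n.
pose D0 := Num.min e e1; have D00 : (0 < D0)%R by rewrite lt_min e0.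
have [|r [/andP[r0 re] rq]] := @lower_density_lt x q (D0 * Num.sqrt k%:R / 2)%R _ xq.
  by rewrite divr_gt0 ?mulr_gt0.
pose D : R := (2 * r / Num.sqrt k%:R)%R.
have Dpos : (0 < D)%R by rewrite divr_gt0 ?mulr_gt0.
have DD0 : (D < D0)%R by rewrite ltr_pdivrMr // mulrC; lra.
have DE : (D / 2 * Num.sqrt k%:R = r)%R by rewrite /D; field; rewrite gt_eqF.
have H0 := hausdorff_content_ge0 n (f @` (eball x r `&` Q)).
move: rq H0; set H := hausdorff_content n _ => rq H0.
have Hfin : H \is a fin_num by rewrite ge0_fin_numE // (lt_le_trans rq) // leey.
have q0 : (0 < K * q)%R.
  have wr0 : (0 < omega n * r ^+ n)%R by rewrite mulr_gt0 ?omega_gt0 ?exprn_gt0.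
  have := le_lt_trans H0 rq; rewrite lte_fin pmulr_lgt0 // => q0.
  by apply: mulr_gt0 => //; exact: cube_constant_gt0.
(* the content equals [K * q * s ^+ n], so that any side above [s] is large enough *)
pose s := ((fine H / (K * q)) `^ n%:R^-1)%R.
have sn : (K * q * s ^+ n = fine H)%R.
  rewrite /s -powR_mulrn ?powR_ge0 // -powRrM mulVf ?pnatr_eq0 ?gtn_eqF // powRr1.
    by rewrite mulrC divfK // gt_eqF.
  by apply: divr_ge0; [exact: fine_ge0|exact: ltW].
have sD : (s < D)%R.
  rewrite -(@ltr_pXn2r _ n) ?nnegrE ?powR_ge0 ?ltW // -(ltr_pM2l q0) sn.
  by rewrite -lte_fin fineK // mulrAC cube_constantE mulrC.
have [j [/andP[sj jD] jx jnear]] := basis x s D sD Dpos.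
exists j; split=> //; last by apply: lt_trans jD (lt_le_trans DD0 _); rewrite ge_min lexx.
have jQ : open_cube (a j) (d j) `<=` eball x r `&` Q.
  move=> y jy; split.
    by rewrite /eball /= -DE mulrC; apply: edist_lt => // i; exact: jnear.
  apply/WQ/e1W => i; apply: lt_trans (jnear y jy i) _.
  have : (D0 <= e1)%R by rewrite ge_min lexx orbT.
  by lra.
have dm0 : 0 <= (d j ^+ m)%:E by rewrite lee_fin exprn_ge0 // ltW.
rewrite /cheap /= exprD mulrA EFinM lee_wpmul2r //.
apply: le_trans (le_hausdorff_content n (image_subset f jQ)) _.
rewrite -/H -[H]fineK // lee_fin -sn ler_pM2l //.
by rewrite lerXn2r ?nnegrE ?powR_ge0 ?ltW.
Qed.

End lower_density.

(** * The interior of a cube, and the integral estimate *)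

Section box.
Context {R : realType} {k : nat}.

Lemma is_cube_interior (Q : set (euclid R k)) : is_cube Q ->
  measurable Q /\ exists W, [/\ W `<=` Q, coordinate_open W, measurable W,
     lebesgue_tuple k W < +oo & lebesgue_tuple k (Q `\` W) = 0].
Proof.
move=> [c [D [lo [hi [D0 QE]]]]].
have mQ : measurable Q by rewrite QE; exact: measurable_cube.
have WQ : open_cube c D `<=` Q.
  rewrite QE => x /= Wx i; have /andP[ax xb] := Wx i; rewrite in_itv /=.
  by case: (lo i); case: (hi i); rewrite /= ?ax ?xb ?ltW.
have mW := measurable_open_cube c D.
have muW := lebesgue_tuple_open_cube c D0.
have muQ : lebesgue_tuple k Q = (D ^+ k)%:E by rewrite QE; exact: lebesgue_tuple_cube.
split=> //; exists (open_cube c D); split=> //; first exact: coordinate_open_cube.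
  by rewrite muW ltry.
have muQoo : lebesgue_tuple k Q < +oo by rewrite muQ ltry.
have dif : lebesgue_tuple k Q - lebesgue_tuple k (open_cube c D) = 0.
  by rewrite muQ muW subee.
by rewrite measureD ?setIidr.
Qed.
End box.

Unset Implicit Arguments.
Set Strict Implicit.

Theorem proposition5p1 (R : realType) (n m : nat) (n_gt0 : (0 < n)%N)
    (m_gt0 : (0 < m)%N) (Q : set (euclid R (n + m))) (cubeQ : is_cube Q)
    (X : metricType R) (f : euclid R (n + m) -> X)
    (lipf : lipschitz_map Q f) :
  hausdorff_content_map n m f Q <=
    (omega n / 2 ^+ n * ((n + m)%:R `^ (n%:R / 2)))%:E *
      \int[lebesgue_tuple (n + m)]_(x in Q) lower_density n Q f x
  /\
  (omega n / 2 ^+ n * ((n + m)%:R `^ (n%:R / 2)))%:E *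
      \int[lebesgue_tuple (n + m)]_(x in Q) lower_density n Q f x <=
    (omega n / 2 ^+ n * ((n + m)%:R `^ (n%:R / 2)))%:E *
      \int[lebesgue_tuple (n + m)]_(x in Q) upper_density n Q f x.
Proof.
have nm0 : (0 < n + m)%N by rewrite addn_gt0 n_gt0.
have K0 := @cube_constant_gt0 R _ _ n_gt0 nm0.
have theta0 x : 0 <= lower_density n Q f x by exact: lower_density_ge0.
set K := (omega n / _ * _)%R in K0 *; split; last first.
  apply: lee_wpmul2l; first by rewrite lee_fin ltW.
  apply: ge0_le_integral_nonmeasurable => x _ //.
  exact: limf_einf_le_esup.
(* [K] is positive, so only a finite integral needs an argument *)
have [Ioo|] := ltP (\int[lebesgue_tuple (n + m)]_(x in Q) lower_density n Q f x) +oo;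
    last by rewrite leye_eq => /eqP->; rewrite gt0_muley ?leey.
have [mQ [W [WQ oW mW Woo QW0]]] := is_cube_interior cubeQ.
have [a [d basis]] := @cube_basis_exists R (n + m).
have cost0 j : 0 <= hausdorff_content n (f @` open_cube (a j) (d j)) * (d j ^+ m)%:E.
  rewrite mule_ge0 ?hausdorff_content_ge0 // lee_fin exprn_ge0 // ltW //.
  exact: basis.1.
apply/lee_addgt0Pr => e e0.
set V := (fine (lebesgue_tuple (n + m) W) + 1)%R.
have V0 : (0 < V)%R by rewrite ltr_wpDl ?fine_ge0.
have [||J [tJ JW J0 Jcost]] := @cheap_packing_exists R (n + m) a d basis.1 Q W
  (lower_density n Q f) K _ mQ mW oW WQ Woo (fun x _ => theta0 x) (ltW K0) cost0 _
  (e / (K * V))%R _ Ioo.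
- by move=> q x Wx xq; exact: (lower_density_vitali_limit n_gt0 nm0 m basis oW WQ Wx xq).
- by apply: divr_gt0 => //; exact: mulr_gt0.
apply: le_trans (le_trans Jcost _).
  apply: ereal_inf_lbound; exists J, a, d; split=> //; split=> //.
  - by move=> j _; exact: basis.1.
  - by move=> j Jj; exact: subset_trans (JW j Jj) WQ.
  - have mU : measurable (\bigcup_(j in J) open_cube (a j) (d j)) by exact: measurable_cubes.
    exists ((Q `\` W) `|` (W `\` \bigcup_(j in J) open_cube (a j) (d j))); split.
    + by apply: measurableU; exact: measurableD.
    + apply/eqP; rewrite eq_le measure_ge0 andbT -[leRHS]adde0 -{1}QW0 -J0.
      by apply: measureU2; exact: measurableD.
    + by move=> x [Qx nx]; have [Wx|nW] := pselect (W x); [right|left].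
have I0 : 0 <= \int[lebesgue_tuple (n + m)]_(x in Q) lower_density n Q f x.
  exact: integral_ge0.
have eV0 : 0 <= (e / (K * V) * V)%:E.
  by rewrite lee_fin ltW // mulr_gt0 // divr_gt0 // mulr_gt0.
rewrite ge0_muleDr //.
rewrite leeD2l // -EFinM lee_fin -/V le_eqVlt; apply/orP; left; apply/eqP.
by field; rewrite !gt_eqF.
Qed.
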